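(* Let $(\mathbf R,\otimes,I)$ be a dagger compact quantaloid, and let $\mathbf S=\mathrm{Maps}(\mathbf R)$. Assume that: (1) $\mathbf S$ is semicartesian when regarded as a monoidal subcategory of $\mathbf R$; (2) the embedding $J:\mathbf S\to\mathbf R$ has a right adjoint $P$ with unit $\{\cdot\}$ and counit $\ni$; (3) there exist an object $\Omega$ of $\mathbf S$ and an $\mathbf S$-morphism $\mathrm{true}:I\to\Omega$ such that for each object $X$ the map $\mathbf S(X,\Omega)\to\mathbf R(X,I)$, $f\mapsto\mathrm{true}^\dagger\circ f$, is a bijection; (4) $\mathbf S$ has pullbacks; (5) for each object $X$ and each subobject (monomorphism) $m:A\to X$ in $\mathbf S$ there is a unique classical morphism $\chi_A:X\to\Omega$ in $\mathbf S$ such that the square formed by $m:A\to X$, $!_A:A\to I$, $\mathrm{true}:I\to\Omega$ and $\chi_A:X\to\Omega$ (so $\chi_A\circ m=\mathrm{true}\circ!_A$) is a pullback square in $\mathbf S$. Then $\mathbf S$ is symmetric monoidal closed.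
   Context: A quantaloid is a category in which every homset is a complete lattice and composition preserves arbitrary suprema in each argument separately. A dagger category is a category with a contravariant involutive identity-on-objects functor $(-)^\dagger$; $f:X\to Y$ is unitary if $f^\dagger\circ f=\mathrm{id}_X$ and $f\circ f^\dagger=\mathrm{id}_Y$. A dagger quantaloid is a quantaloid that is a dagger category such that $r\mapsto r^\dagger$ is an order isomorphism on homsets. A dagger compact category is a symmetric monoidal dagger category $(\mathbf R,\otimes,I)$ with $(f\otimes g)^\dagger=f^\dagger\otimes g^\dagger$, unitary associator, unitors and symmetry $\sigma$, in which each object $X$ has a dual $X^*$ with unit $\eta_X:I\to X^*\otimes X$ and counit $\epsilon_X:X\otimes X^*\to I$ satisfying the zigzag identities and $\sigma_{X,X^*}\circ\epsilon_X^\dagger=\eta_X$. A dagger compact quantaloid is a dagger compact category that is a dagger quantaloid such that $(f,g)\mapsto f\otimes g$ preserves suprema in both arguments separately. A map in $\mathbf R$ is a morphism $f:X\to Y$ with $f^\dagger\circ f\ge\mathrm{id}_X$ and $f\circ f^\dagger\le\mathrm{id}_Y$. $\mathrm{Maps}(\mathbf R)$ is the wide subcategory of maps; it is a symmetric monoidal subcategory of $\mathbf R$ (same $\otimes$, $I$, coherence isomorphisms). A symmetric monoidal category is semicartesian if its monoidal unit $I$ is terminal; $!_X:X\to I$ denotes the unique morphism. In a semicartesian category with left and right unitors $\lambda,\rho$, put $p^1_{X\otimes Y}=\rho_X\circ(\mathrm{id}_X\otimes!_Y):X\otimes Y\to X$ and $p^2_{X\otimes Y}=\lambda_Y\circ(!_X\otimes\mathrm{id}_Y):X\otimes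 Y\to Y$. A morphism $f:X\to Y$ is classical if there is a morphism $\hat f:X\to X\otimes Y$ with $p^2_{X\otimes Y}\circ\hat f=f$ and $p^1_{X\otimes Y}\circ\hat f=\mathrm{id}_X$. *)

(* Defs.v *)
From Stdlib Require Import Setoid Relation_Definitions ProofIrrelevance.
From Corelib Require Import ssrfun.

Set Implicit Arguments.
Unset Strict Implicit.
Unset Printing Implicit Defensive.

Declare Scope cat_scope.
Delimit Scope cat_scope with cat.
Open Scope cat_scope.

Reserved Notation "g ∘ f" (at level 40, left associativity).
Reserved Notation "X ⊗ Y" (at level 38, left associativity).
Reserved Notation "f ⊠ g" (at level 38, left associativity).
Reserved Notation "f ^†" (at level 1, left associativity, format "f ^†").
Reserved Notation "f ⊑ g" (at level 70, no associativity).

Record Category := {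
  Obj :> Type;
  Hom : Obj -> Obj -> Type;
  idm : forall X, Hom X X;
  comp : forall X Y Z, Hom Y Z -> Hom X Y -> Hom X Z;
  comp_assoc : forall W X Y Z (h : Hom Y Z) (g : Hom X Y) (f : Hom W X),
    comp h (comp g f) = comp (comp h g) f;
  comp_id_l : forall X Y (f : Hom X Y), comp (idm Y) f = f;
  comp_id_r : forall X Y (f : Hom X Y), comp f (idm X) = f
}.

Arguments Hom {c} X Y.
Arguments idm {c} X.
Arguments comp {c X Y Z} g f : rename.
Notation "g ∘ f" := (comp g f) : cat_scope.

Record Iso (C : Category) (X Y : C) := {
  iso_hom :> Hom X Y;
  iso_inv : Hom Y X;
  iso_inv_hom : iso_inv ∘ iso_hom = idm X;
  iso_hom_inv : iso_hom ∘ iso_inv = idm Y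
}.

Definition is_mono (C : Category) (X Y : C) (m : Hom X Y) : Prop :=
  forall (Z : C) (g h : Hom Z X), m ∘ g = m ∘ h -> g = h.

(** [P], with [p1 : P -> X] and [p2 : P -> Y], is a pullback of
    [f : X -> Z] and [g : Y -> Z]. *)
Definition is_pullback (C : Category) (P X Y Z : C)
    (p1 : Hom P X) (p2 : Hom P Y) (f : Hom X Z) (g : Hom Y Z) : Prop :=
  f ∘ p1 = g ∘ p2 /\
  forall (Q : C) (q1 : Hom Q X) (q2 : Hom Q Y), f ∘ q1 = g ∘ q2 ->
    exists! u : Hom Q P, p1 ∘ u = q1 /\ p2 ∘ u = q2.

Definition has_pullbacks (C : Category) : Prop :=
  forall (X Y Z : C) (f : Hom X Z) (g : Hom Y Z),
    exists (P : C) (p1 : Hom P X) (p2 : Hom P Y), is_pullback p1 p2 f g.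

Record Functor (C D : Category) := {
  fobj :> C -> D;
  fmap : forall X Y : C, Hom X Y -> Hom (fobj X) (fobj Y);
  fmap_id : forall X : C, fmap (idm X) = idm (fobj X);
  fmap_comp : forall (X Y Z : C) (g : Hom Y Z) (f : Hom X Y),
    fmap (g ∘ f) = fmap g ∘ fmap f
}.

Definition id_functor (C : Category) : Functor C C :=
  {| fobj := fun X : C => X; fmap := fun X Y (f : Hom X Y) => f;
     fmap_id := fun X => eq_refl; fmap_comp := fun X Y Z g f => eq_refl |}.

Definition comp_functor (C D E : Category) (G : Functor D E) (F : Functor C D) :
  Functor C E.
Proof.
refine {| fobj := fun X => G (F X); fmap := fun X Y f => fmap G (fmap F f) |}.
- intros X; now rewrite !fmap_id.
- intros X Y Z g f; now rewrite !fmap_comp.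
Defined.

Record NatTrans (C D : Category) (F G : Functor C D) := {
  component :> forall X : C, Hom (F X) (G X);
  naturality : forall (X Y : C) (f : Hom X Y),
    component Y ∘ fmap F f = fmap G f ∘ component X
}.

Definition is_adjunction (C D : Category) (F : Functor C D) (G : Functor D C)
    (unit : NatTrans (id_functor C) (comp_functor G F))
    (counit : NatTrans (comp_functor F G) (id_functor D)) : Prop :=
  (forall X : C, counit (F X) ∘ fmap F (unit X) = idm (F X)) /\
  (forall Y : D, fmap G (counit Y) ∘ unit (G Y) = idm (G Y)).

Definition has_right_adjoint (C D : Category) (F : Functor C D) : Prop :=
  exists (G : Functor D C)
    (unit : NatTrans (id_functor C) (comp_functor G F))
    (counit : NatTrans (comp_functor F G) (id_functor D)),
    is_adjunction unit counit.

Class SymMonoidal (C : Category) := {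
  tensor : C -> C -> C;
  tensorm : forall X X' Y Y' : C,
    Hom X X' -> Hom Y Y' -> Hom (tensor X Y) (tensor X' Y');
  munit : C;
  tensorm_id : forall X Y : C, tensorm (idm X) (idm Y) = idm (tensor X Y);
  tensorm_comp : forall (X X' X'' Y Y' Y'' : C)
      (f' : Hom X' X'') (f : Hom X X') (g' : Hom Y' Y'') (g : Hom Y Y'),
    tensorm (f' ∘ f) (g' ∘ g) = tensorm f' g' ∘ tensorm f g;

  associator : forall X Y Z : C,
    Iso (tensor (tensor X Y) Z) (tensor X (tensor Y Z));
  lunitor : forall X : C, Iso (tensor munit X) X;
  runitor : forall X : C, Iso (tensor X munit) X;
  symmetry : forall X Y : C, Iso (tensor X Y) (tensor Y X);

  associator_nat : forall (X X' Y Y' Z Z' : C)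
      (f : Hom X X') (g : Hom Y Y') (h : Hom Z Z'),
    associator X' Y' Z' ∘ tensorm (tensorm f g) h =
    tensorm f (tensorm g h) ∘ associator X Y Z;
  lunitor_nat : forall (X X' : C) (f : Hom X X'),
    lunitor X' ∘ tensorm (idm munit) f = f ∘ lunitor X;
  runitor_nat : forall (X X' : C) (f : Hom X X'),
    runitor X' ∘ tensorm f (idm munit) = f ∘ runitor X;
  symmetry_nat : forall (X X' Y Y' : C) (f : Hom X X') (g : Hom Y Y'),
    symmetry X' Y' ∘ tensorm f g = tensorm g f ∘ symmetry X Y;

  pentagon : forall W X Y Z : C,
    associator W X (tensor Y Z) ∘ associator (tensor W X) Y Z =
    tensorm (idm W) (associator X Y Z) ∘ associator W (tensor X Y) Z
      ∘ tensorm (associator W X Y) (idm Z);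
  triangle : forall X Y : C,
    tensorm (idm X) (lunitor Y) ∘ associator X munit Y =
    tensorm (runitor X) (idm Y);
  hexagon : forall X Y Z : C,
    associator Y Z X ∘ symmetry X (tensor Y Z) ∘ associator X Y Z =
    tensorm (idm Y) (symmetry X Z) ∘ associator Y X Z
      ∘ tensorm (symmetry X Y) (idm Z);
  symmetry_invol : forall X Y : C,
    symmetry Y X ∘ symmetry X Y = idm (tensor X Y)
}.

Arguments munit C {SymMonoidal} : rename.
Notation "X ⊗ Y" := (tensor X Y) : cat_scope.
Notation "f ⊠ g" := (tensorm f g) : cat_scope.

Definition tensor_right (C : Category) {M : SymMonoidal C} (X : C) : Functor C C.
Proof.
refine {| fobj := fun Y : C => Y ⊗ X;
          fmap := fun (Y Z : C) (f : Hom Y Z) => f ⊠ idm X |}.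
- intros Y; apply tensorm_id.
- intros Y Z W g f; now rewrite <- tensorm_comp, comp_id_l.
Defined.

Definition symmetric_monoidal_closed (C : Category) {M : SymMonoidal C} : Prop :=
  forall X : C, has_right_adjoint (tensor_right X).

Arguments symmetric_monoidal_closed C {M}.

Class Semicartesian (C : Category) {M : SymMonoidal C} := {
  bang : forall X : C, Hom X (munit C);
  bang_unique : forall (X : C) (f : Hom X (munit C)), f = bang X
}.

Arguments Semicartesian C {M}.

Definition tproj1 (C : Category) {M : SymMonoidal C} {T : Semicartesian C}
    (X Y : C) : Hom (X ⊗ Y) X :=
  runitor X ∘ (idm X ⊠ bang Y).

Definition tproj2 (C : Category) {M : SymMonoidal C} {T : Semicartesian C}
    (X Y : C) : Hom (X ⊗ Y) Y :=
  lunitor Y ∘ (bang X ⊠ idm Y).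

Definition classical (C : Category) {M : SymMonoidal C} {T : Semicartesian C}
    (X Y : C) (f : Hom X Y) : Prop :=
  exists fhat : Hom X (X ⊗ Y), tproj2 X Y ∘ fhat = f /\ tproj1 X Y ∘ fhat = idm X.

Definition is_sup (A : Type) (le : relation A) (S : A -> Prop) (s : A) : Prop :=
  (forall a, S a -> le a s) /\ (forall b, (forall a, S a -> le a b) -> le s b).

Definition is_inf (A : Type) (le : relation A) (S : A -> Prop) (i : A) : Prop :=
  (forall a, S a -> le i a) /\ (forall b, (forall a, S a -> le b a) -> le b i).

Definition is_complete_lattice (A : Type) (le : relation A) : Prop :=
  order A le /\
  (forall S : A -> Prop, exists s, is_sup le S s) /\
  (forall S : A -> Prop, exists i, is_inf le S i).

Definition preserves_sups (A B : Type) (leA : relation A) (leB : relation B)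
    (h : A -> B) : Prop :=
  forall (S : A -> Prop) (s : A), is_sup leA S s ->
    is_sup leB (fun b => exists a, S a /\ h a = b) (h s).

Class Quantaloid (C : Category) := {
  hle : forall X Y : C, relation (Hom X Y);
  hom_complete : forall X Y : C, is_complete_lattice (@hle X Y);
  comp_sup_r : forall (X Y Z : C) (g : Hom Y Z),
    preserves_sups (@hle X Y) (@hle X Z) (fun f => g ∘ f);
  comp_sup_l : forall (X Y Z : C) (f : Hom X Y),
    preserves_sups (@hle Y Z) (@hle X Z) (fun g => g ∘ f)
}.

Notation "f ⊑ g" := (hle f g) : cat_scope.

Class Dagger (C : Category) := {
  dag : forall X Y : C, Hom X Y -> Hom Y X;
  dag_id : forall X : C, dag (idm X) = idm X;
  dag_comp : forall (X Y Z : C) (g : Hom Y Z) (f : Hom X Y),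
    dag (g ∘ f) = dag f ∘ dag g;
  dag_invol : forall (X Y : C) (f : Hom X Y), dag (dag f) = f
}.

Notation "f ^†" := (dag f) : cat_scope.

Definition unitary (C : Category) {D : Dagger C} (X Y : C) (f : Hom X Y) : Prop :=
  f^† ∘ f = idm X /\ f ∘ f^† = idm Y.

(** [dag] is already a bijection on homsets by [dag_invol]. *)
Class DaggerQuantaloid (C : Category) {D : Dagger C} {Q : Quantaloid C} : Prop :=
  dag_order_iso : forall (X Y : C) (f g : Hom X Y), f ⊑ g <-> f^† ⊑ g^†.

Record DaggerDual (C : Category) {M : SymMonoidal C} {D : Dagger C} (X : C) := {
  dual : C;
  coev : Hom (munit C) (dual ⊗ X);
  ev : Hom (X ⊗ dual) (munit C);
  zigzag : lunitor X ∘ (ev ⊠ idm X) ∘ iso_inv (associator X dual X)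
             ∘ (idm X ⊠ coev) ∘ iso_inv (runitor X) = idm X;
  zigzag_dual : runitor dual ∘ (idm dual ⊠ ev) ∘ associator dual X dual
             ∘ (coev ⊠ idm dual) ∘ iso_inv (lunitor dual) = idm dual;
  symmetry_dag_ev : symmetry X dual ∘ ev^† = coev
}.

Class DaggerCompact (C : Category) {M : SymMonoidal C} {D : Dagger C} := {
  dag_tensorm : forall (X X' Y Y' : C) (f : Hom X X') (g : Hom Y Y'),
    (f ⊠ g)^† = f^† ⊠ g^†;
  associator_unitary : forall X Y Z : C, unitary (associator X Y Z);
  lunitor_unitary : forall X : C, unitary (lunitor X);
  runitor_unitary : forall X : C, unitary (runitor X);
  symmetry_unitary : forall X Y : C, unitary (symmetry X Y);
  dagger_dual : forall X : C, DaggerDual X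
}.

Arguments DaggerQuantaloid C {D Q}.
Arguments DaggerCompact C {M D}.

Record DaggerCompactQuantaloid := {
  dcq_cat :> Category;
  #[global] dcq_monoidal :: SymMonoidal dcq_cat;
  #[global] dcq_dagger :: Dagger dcq_cat;
  #[global] dcq_quantaloid :: Quantaloid dcq_cat;
  #[global] dcq_dagger_compact :: DaggerCompact dcq_cat;
  #[global] dcq_dagger_quantaloid :: DaggerQuantaloid dcq_cat;
  tensorm_sup_r : forall (X X' Y Y' : dcq_cat) (f : Hom X X'),
    preserves_sups (@hle _ _ Y Y') (@hle _ _ (X ⊗ Y) (X' ⊗ Y')) (fun g => f ⊠ g);
  tensorm_sup_l : forall (X X' Y Y' : dcq_cat) (g : Hom Y Y'),
    preserves_sups (@hle _ _ X X') (@hle _ _ (X ⊗ Y) (X' ⊗ Y')) (fun f => f ⊠ g)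
}.

Definition is_map (R : DaggerCompactQuantaloid) (X Y : R) (f : Hom X Y) : Prop :=
  idm X ⊑ f^† ∘ f /\ f ∘ f^† ⊑ idm Y.

Record MapHom (R : DaggerCompactQuantaloid) (X Y : R) := {
  map_hom :> Hom X Y;
  map_hom_is_map : is_map map_hom
}.

Lemma map_ext (R : DaggerCompactQuantaloid) (X Y : R) (f g : MapHom X Y) :
  map_hom f = map_hom g -> f = g.
Proof.
destruct f as [f Hf], g as [g Hg]; simpl; intros <-.
now rewrite (proof_irrelevance _ Hf Hg).
Qed.

Lemma hle_refl (C : Category) (Q : Quantaloid C) (X Y : C) (f : Hom X Y) : f ⊑ f.
Proof. destruct (hom_complete X Y) as [[r _ _] _]; apply r. Qed.

Lemma hle_trans (C : Category) (Q : Quantaloid C) (X Y : C) (f g h : Hom X Y) :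
  f ⊑ g -> g ⊑ h -> f ⊑ h.
Proof. destruct (hom_complete X Y) as [[_ t _] _]; apply t. Qed.

Lemma preserves_sups_mono (A B : Type) (leA : relation A) (leB : relation B)
    (h : A -> B) (a a' : A) :
  order A leA -> preserves_sups leA leB h ->
  leA a a' -> leB (h a) (h a').
Proof.
intros [rA _ _] Hh Haa'.
assert (Hs : is_sup leA (fun x => x = a \/ x = a') a').
{ split.
  - intros x [-> | ->]; [exact Haa' | apply rA].
  - intros b H; apply H; now right. }
apply (proj1 (Hh _ _ Hs)).
exists a; split; [now left | reflexivity].
Qed.

Lemma comp_mono (C : Category) (Q : Quantaloid C) (X Y Z : C)
    (g g' : Hom Y Z) (f f' : Hom X Y) :
  g ⊑ g' -> f ⊑ f' -> g ∘ f ⊑ g' ∘ f'.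
Proof.
intros Hg Hf; apply hle_trans with (g' ∘ f).
- exact (preserves_sups_mono (proj1 (hom_complete _ _)) (comp_sup_l f) Hg).
- exact (preserves_sups_mono (proj1 (hom_complete _ _)) (comp_sup_r g') Hf).
Qed.

Lemma tensorm_mono (R : DaggerCompactQuantaloid) (X X' Y Y' : R)
    (f f' : Hom X X') (g g' : Hom Y Y') :
  f ⊑ f' -> g ⊑ g' -> f ⊠ g ⊑ f' ⊠ g'.
Proof.
intros Hf Hg; apply hle_trans with (f' ⊠ g).
- exact (preserves_sups_mono (proj1 (hom_complete _ _)) (tensorm_sup_l g) Hf).
- exact (preserves_sups_mono (proj1 (hom_complete _ _)) (tensorm_sup_r f') Hg).
Qed.

Lemma unitary_is_map (R : DaggerCompactQuantaloid) (X Y : R) (f : Hom X Y) :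
  unitary f -> is_map f.
Proof. intros [H1 H2]; split; rewrite ?H1, ?H2; apply hle_refl. Qed.

Lemma unitary_inv_is_map (R : DaggerCompactQuantaloid) (X Y : R) (f : Iso X Y) :
  unitary f -> is_map (iso_inv f).
Proof.
intros [H1 H2].
assert (E : iso_inv f = f^†).
{ now rewrite <- (comp_id_r (iso_inv f)), <- H2, comp_assoc, iso_inv_hom, comp_id_l. }
apply unitary_is_map; rewrite E; split; now rewrite dag_invol.
Qed.

Lemma id_is_map (R : DaggerCompactQuantaloid) (X : R) : is_map (idm X).
Proof. split; rewrite dag_id, comp_id_l; apply hle_refl. Qed.

Lemma comp_is_map (R : DaggerCompactQuantaloid) (X Y Z : R)
    (g : Hom Y Z) (f : Hom X Y) :
  is_map g -> is_map f -> is_map (g ∘ f).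
Proof.
intros [g1 g2] [f1 f2]; split; rewrite dag_comp.
- apply hle_trans with (1 := f1).
  replace ((f^† ∘ g^†) ∘ (g ∘ f)) with (f^† ∘ ((g^† ∘ g) ∘ f))
    by now rewrite !comp_assoc.
  apply comp_mono; [apply hle_refl |].
  rewrite <- (comp_id_l f) at 1; apply comp_mono; [exact g1 | apply hle_refl].
- apply hle_trans with (2 := g2).
  replace ((g ∘ f) ∘ (f^† ∘ g^†)) with (g ∘ ((f ∘ f^†) ∘ g^†))
    by now rewrite !comp_assoc.
  apply comp_mono; [apply hle_refl |].
  rewrite <- (comp_id_l (g^†)) at 2; apply comp_mono; [exact f2 | apply hle_refl].
Qed.

Lemma tensorm_is_map (R : DaggerCompactQuantaloid) (X X' Y Y' : R)
    (f : Hom X X') (g : Hom Y Y') :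
  is_map f -> is_map g -> is_map (f ⊠ g).
Proof.
intros [f1 f2] [g1 g2]; split; rewrite dag_tensorm, <- tensorm_comp, <- tensorm_id;
  now apply tensorm_mono.
Qed.

Definition Maps (R : DaggerCompactQuantaloid) : Category.
Proof.
refine {| Obj := R; Hom := @MapHom R;
          idm := fun X => Build_MapHom (id_is_map X);
          comp := fun X Y Z g f =>
            Build_MapHom (comp_is_map (map_hom_is_map g) (map_hom_is_map f)) |}.
- intros; apply map_ext, comp_assoc.
- intros; apply map_ext, comp_id_l.
- intros; apply map_ext, comp_id_r.
Defined.

Definition map_iso (R : DaggerCompactQuantaloid) (X Y : R) (f : Iso X Y)
  (Hf : unitary f) : @Iso (Maps R) X Y.
Proof.
refine (@Build_Iso (Maps R) X Y (Build_MapHom (unitary_is_map Hf))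
          (Build_MapHom (unitary_inv_is_map Hf)) _ _).
- apply map_ext, iso_inv_hom.
- apply map_ext, iso_hom_inv.
Defined.

#[global] Instance Maps_monoidal (R : DaggerCompactQuantaloid) : SymMonoidal (Maps R).
Proof.
refine (@Build_SymMonoidal (Maps R) (fun X Y : R => X ⊗ Y)
  (fun X X' Y Y' (f : MapHom X X') (g : MapHom Y Y') =>
     Build_MapHom (tensorm_is_map (map_hom_is_map f) (map_hom_is_map g)))
  (munit R) _ _
  (fun X Y Z : R => map_iso (associator_unitary X Y Z))
  (fun X : R => map_iso (lunitor_unitary X))
  (fun X : R => map_iso (runitor_unitary X))
  (fun X Y : R => map_iso (symmetry_unitary X Y)) _ _ _ _ _ _ _ _);
  intros; apply map_ext; simpl.
- apply tensorm_id.
- apply tensorm_comp.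
- apply associator_nat.
- apply lunitor_nat.
- apply runitor_nat.
- apply symmetry_nat.
- apply pentagon.
- apply triangle.
- apply hexagon.
- apply symmetry_invol.
Defined.

Definition embedding (R : DaggerCompactQuantaloid) : Functor (Maps R) R :=
  {| fobj := fun X : Maps R => (X : R);
     fmap := fun (X Y : Maps R) (f : Hom X Y) => map_hom f;
     fmap_id := fun X => eq_refl; fmap_comp := fun X Y Z g f => eq_refl |}.

(* Main.v *)
From Stdlib Require Import ClassicalEpsilon.
Require Import Defs.
From Corelib Require Import ssrfun.

(** A dagger compact category is closed, so relations [Z ⊗ X -> Y] are named by relations
    [Z -> Y ⊗ dual X] and hence, by the adjunction, by maps [Z -> E := P (Y ⊗ dual X)]. The
    internal hom is the subobject of [E] of names of maps. A relation [Z ⊗ X -> Y] is a map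
    iff its transpose [Z ⊗ X -> P Y] factors through the singleton [Y -> P Y], i.e. iff the
    classifying morphism [P Y -> Omega] of the singleton sends it to [truth ∘ !]. Morphisms
    [Z ⊗ X -> Omega] are relations [Z ⊗ X -> I], hence maps [Z -> P (I ⊗ dual X)], so
    this condition is an equation between maps out of [Z], solved by a pullback. *)

Set Implicit Arguments.
Unset Strict Implicit.

(** * Universal arrows and right adjoints *)

(** The pair [G], [e] is terminal among arrows from [F] to [Y]. This is a right adjoint at the
    single object [Y], so it can be built one object at a time. *)
Definition is_universal_arrow (C D : Category) (F : Functor C D) (Y : D) (G : C)
    (e : Hom (F G) Y) : Prop :=
  forall (Z : C) (r : Hom (F Z) Y), exists! g : Hom Z G, e ∘ fmap F g = r.

Arguments is_universal_arrow {C D} F {Y G} e.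

Lemma universal_arrow_inj (C D : Category) (F : Functor C D) (Y : D) (G : C)
    (e : Hom (F G) Y) :
  is_universal_arrow F e ->
  forall (Z : C) (g h : Hom Z G), e ∘ fmap F g = e ∘ fmap F h -> g = h.
Proof.
intros U Z g h E; destruct (U _ (e ∘ fmap F h)) as [x [_ V]].
now rewrite <- (V g E), <- (V h eq_refl).
Qed.

(** Factor first through [e], then through [e']. This will join compact closure to the power
    adjunction. *)
Lemma universal_arrow_comp (A B C : Category) (F : Functor A B) (G : Functor B C)
    (Y : C) (Y' : B) (Y'' : A) (e : Hom (G Y') Y) (e' : Hom (F Y'') Y') :
  is_universal_arrow G e -> is_universal_arrow F e' ->
  is_universal_arrow (comp_functor G F) (e ∘ fmap G e').
Proof.
intros U U' Z r; destruct (U _ r) as [s [Es Us]], (U' _ s) as [g [Eg Ug]].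
exists g; split; simpl.
- now rewrite <- comp_assoc, <- fmap_comp, Eg.
- intros h E; apply Ug, eq_sym, Us; now rewrite fmap_comp, comp_assoc.
Qed.

Lemma adjunction_universal_arrow (C D : Category) (F : Functor C D) (G : Functor D C)
    (unit : NatTrans (id_functor C) (comp_functor G F))
    (counit : NatTrans (comp_functor F G) (id_functor D)) :
  is_adjunction unit counit -> forall Y : D, is_universal_arrow F (counit Y).
Proof.
intros [H1 H2] Y Z r; simpl in H1, H2; exists (fmap G r ∘ unit Z); split.
- simpl; rewrite fmap_comp, comp_assoc.
  pose proof (naturality counit r) as N; simpl in N; rewrite N.
  rewrite <- comp_assoc; simpl; now rewrite H1, comp_id_r.
- intros g <-; simpl.
  pose proof (naturality unit g) as N; simpl in N.
  now rewrite fmap_comp, <- comp_assoc, <- N, comp_assoc, H2, comp_id_l.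
Qed.

(** Choice selects a universal arrow for each [Y] and a transpose for each morphism; every
    adjunction law then follows from uniqueness of transposes. *)
Lemma universal_arrows_right_adjoint (C D : Category) (F : Functor C D) :
  (forall Y : D, exists (G : C) (e : Hom (F G) Y), is_universal_arrow F e) ->
  has_right_adjoint F.
Proof.
intros H.
pose (G Y := proj1_sig (constructive_indefinite_description _ (H Y))).
pose (GP Y := proj2_sig (constructive_indefinite_description _ (H Y))).
pose (e Y := proj1_sig (constructive_indefinite_description _ (GP Y)) : Hom (F (G Y)) Y).
assert (eU : forall Y, is_universal_arrow F (e Y))
  by (intros Y; exact (proj2_sig (constructive_indefinite_description _ (GP Y)))).
clearbody e; clear GP; clearbody G.
pose (tr Z Y (r : Hom (F Z) Y) :=
  proj1_sig (constructive_indefinite_description _ (eU Y Z r)) : Hom Z (G Y)).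
assert (trE : forall Z Y (r : Hom (F Z) Y), e Y ∘ fmap F (tr Z Y r) = r)
  by (intros Z Y r;
      exact (proj1 (proj2_sig (constructive_indefinite_description _ (eU Y Z r))))).
(* From here on, morphisms into [G Y] are compared after composing with [e Y]. *)
pose proof (fun Y => universal_arrow_inj (eU Y)) as trU.
clearbody tr.
unshelve epose (GF := {| fobj := G; fmap := fun X Y f => tr _ _ (f ∘ e X) |}).
{ intros X; apply (trU _); now rewrite trE, fmap_id, comp_id_l, comp_id_r. }
{ intros X Y Z g f; apply (trU _).
  now rewrite fmap_comp, (comp_assoc (e Z)), !trE, <- !comp_assoc, trE. }
unshelve epose (unit := @Build_NatTrans C C (id_functor C) (comp_functor GF F)
                          (fun X => tr X (F X) (idm (F X))) _).
{ intros X Y f; apply (trU _); simpl.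
  now rewrite !fmap_comp, !comp_assoc, !trE, <- comp_assoc, trE, comp_id_l, comp_id_r. }
unshelve epose (counit := @Build_NatTrans D D (comp_functor F GF) (id_functor D) e _).
{ intros X Y f; simpl; apply trE. }
exists GF, unit, counit.
split; simpl.
- intros X; apply trE.
- intros Y; apply (trU _).
  now rewrite fmap_comp, comp_assoc, trE, <- comp_assoc, trE, fmap_id.
Qed.

(** * Cancelling isomorphisms, and monoidal coherence *)

Lemma iso_mono (C : Category) (X Y Z : C) (i : Iso Y Z) (f g : Hom X Y) :
  i ∘ f = i ∘ g -> f = g.
Proof.
intros E; now rewrite <- (comp_id_l f), <- (comp_id_l g), <- (iso_inv_hom i),
  <- !comp_assoc, E.
Qed.

Lemma iso_epi (C : Category) (X Y Z : C) (i : Iso X Y) (f g : Hom Y Z) :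
  f ∘ i = g ∘ i -> f = g.
Proof.
intros E; now rewrite <- (comp_id_r f), <- (comp_id_r g), <- (iso_hom_inv i),
  !comp_assoc, E.
Qed.

Section Monoidal.

Context (C : Category) {M : SymMonoidal C}.

Lemma tensorm_comp_id (X Y Z W : C) (g : Hom Y Z) (f : Hom X Y) :
  (g ∘ f) ⊠ idm W = (g ⊠ idm W) ∘ (f ⊠ idm W).
Proof. now rewrite <- tensorm_comp, comp_id_l. Qed.

Lemma tensorm_id_comp (X Y Z W : C) (g : Hom Y Z) (f : Hom X Y) :
  idm W ⊠ (g ∘ f) = (idm W ⊠ g) ∘ (idm W ⊠ f).
Proof. now rewrite <- tensorm_comp, comp_id_l. Qed.

Lemma tensorm_interchange (X X' Y Y' : C) (f : Hom X X') (g : Hom Y Y') :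
  (idm X' ⊠ g) ∘ (f ⊠ idm Y) = (f ⊠ idm Y') ∘ (idm X ⊠ g).
Proof. now rewrite <- !tensorm_comp, !comp_id_l, !comp_id_r. Qed.

Lemma tensorm_munit_inj (X Y : C) (f g : Hom X Y) :
  f ⊠ idm (munit C) = g ⊠ idm (munit C) -> f = g.
Proof.
intros E; apply (iso_epi (i := runitor X)); now rewrite <- !runitor_nat, E.
Qed.

(** Kelly's coherence law: after tensoring with the unit, which is faithful, it follows from the
    pentagon and two triangles. *)
Lemma runitor_tensor (X Y : C) :
  runitor (X ⊗ Y) = (idm X ⊠ runitor Y) ∘ associator X Y (munit C) :> Hom _ _.
Proof.
apply tensorm_munit_inj, (iso_mono (i := associator X Y (munit C))).
rewrite tensorm_comp_id, comp_assoc, associator_nat, <- triangle, comp_assoc.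
rewrite <- tensorm_id, associator_nat, <- (triangle Y), tensorm_id_comp.
rewrite <- !comp_assoc; f_equal; rewrite pentagon; now rewrite <- !comp_assoc.
Qed.

Lemma associator_inv_nat (X X' Y Y' Z Z' : C)
    (f : Hom X X') (g : Hom Y Y') (h : Hom Z Z') :
  iso_inv (associator X' Y' Z') ∘ (f ⊠ (g ⊠ h)) =
  (f ⊠ g ⊠ h) ∘ iso_inv (associator X Y Z).
Proof.
apply (iso_mono (i := associator X' Y' Z')), (iso_epi (i := associator X Y Z)).
now rewrite !comp_assoc, iso_hom_inv, comp_id_l, associator_nat, <- !comp_assoc,
  iso_inv_hom, comp_id_r.
Qed.

Lemma runitor_inv_nat (X X' : C) (f : Hom X X') :
  (f ⊠ idm (munit C)) ∘ iso_inv (runitor X) = iso_inv (runitor X') ∘ f.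
Proof.
apply (iso_mono (i := runitor X')).
now rewrite !comp_assoc, runitor_nat, <- comp_assoc, !iso_hom_inv, comp_id_l, comp_id_r.
Qed.

Lemma triangle_inv (X Y : C) :
  associator X (munit C) Y ∘ (iso_inv (runitor X) ⊠ idm Y) =
  idm X ⊠ iso_inv (lunitor Y).
Proof.
rewrite <- (comp_id_l (associator _ _ _)), <- tensorm_id, <- (iso_inv_hom (lunitor Y)).
rewrite tensorm_id_comp, <- (comp_assoc _ _ (associator _ _ _)), triangle.
now rewrite <- comp_assoc, <- tensorm_comp_id, iso_hom_inv, tensorm_id, comp_id_r.
Qed.

Lemma pentagon_inv (W X Y Z : C) :
  (associator W X Y ⊠ idm Z) ∘ iso_inv (associator (W ⊗ X) Y Z) =
  iso_inv (associator W (X ⊗ Y) Z) ∘ (idm W ⊠ iso_inv (associator X Y Z))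
    ∘ associator W X (Y ⊗ Z).
Proof.
apply (iso_epi (i := associator (W ⊗ X) Y Z)).
rewrite <- !comp_assoc, iso_inv_hom, comp_id_r, pentagon, !comp_assoc.
rewrite <- (comp_assoc _ _ (idm W ⊠ associator X Y Z)), <- tensorm_id_comp.
now rewrite iso_inv_hom, tensorm_id, comp_id_r, iso_inv_hom, comp_id_l.
Qed.

End Monoidal.

(** * Closed structure of a dagger compact category *)

Lemma unitary_inv_dag (C : Category) (D : Dagger C) (X Y : C) (i : Iso X Y) :
  unitary i -> iso_inv i = i^†.
Proof.
intros [_ H]; apply (iso_mono (i := i)); now rewrite iso_hom_inv, H.
Qed.

(** Daggers of the zigzag identities make [ev^†] and [coev^†] the unit and counit
    of [- ⊗ X ⊣ - ⊗ dual X], so that no symmetry is involved. *)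
Section CompactClosed.

Context (C : Category) {M : SymMonoidal C} {D : Dagger C} {K : DaggerCompact C}.

Context (X : C).

Local Notation X' := (dual (dagger_dual X)).
Local Notation n := ((ev (dagger_dual X))^†).
Local Notation c := ((coev (dagger_dual X))^†).

Lemma zigzag_dag :
  runitor X ∘ (idm X ⊠ c) ∘ associator X X' X ∘ (n ⊠ idm X) ∘ iso_inv (lunitor X)
  = idm X.
Proof.
pose proof (f_equal (@dag _ _ _ _) (zigzag (dagger_dual X))) as E.
rewrite (unitary_inv_dag (associator_unitary _ _ _)),
  (unitary_inv_dag (runitor_unitary _)), !dag_comp, !dag_tensorm, !dag_invol,
  !dag_id, <- (unitary_inv_dag (lunitor_unitary _)), !comp_assoc in E.
exact E.
Qed.

Lemma zigzag_dual_dag :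
  lunitor X' ∘ (c ⊠ idm X') ∘ iso_inv (associator X' X X') ∘ (idm X' ⊠ n)
    ∘ iso_inv (runitor X') = idm X'.
Proof.
pose proof (f_equal (@dag _ _ _ _) (zigzag_dual (dagger_dual X))) as E.
rewrite (unitary_inv_dag (lunitor_unitary _)), !dag_comp, !dag_tensorm, !dag_invol,
  !dag_id, <- (unitary_inv_dag (runitor_unitary _)),
  <- (unitary_inv_dag (associator_unitary _ _ _)), !comp_assoc in E.
exact E.
Qed.

Definition compact_eval (Y : C) : Hom ((Y ⊗ X') ⊗ X) Y :=
  runitor Y ∘ (idm Y ⊠ c) ∘ associator Y X' X.

Definition compact_curry (Z Y : C) (r : Hom (Z ⊗ X) Y) : Hom Z (Y ⊗ X') :=
  (r ⊠ idm X') ∘ iso_inv (associator Z X X') ∘ (idm Z ⊠ n) ∘ iso_inv (runitor Z).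

Arguments compact_curry {Z Y} r.

(** Naturality in [Z], which reduces uniqueness of transposes to the transpose of [compact_eval]. *)
Lemma compact_curry_comp (W Z Y : C) (r : Hom (Z ⊗ X) Y) (s : Hom W Z) :
  compact_curry (r ∘ (s ⊠ idm X)) = compact_curry r ∘ s.
Proof.
unfold compact_curry.
rewrite tensorm_comp_id, <- (comp_assoc _ (s ⊠ idm X ⊠ idm X')), <- associator_inv_nat.
rewrite tensorm_id, <- !comp_assoc, (comp_assoc (s ⊠ _)), <- tensorm_interchange.
now rewrite <- (comp_assoc (idm Z ⊠ n)), runitor_inv_nat.
Qed.

Lemma compact_curryK (Z Y : C) (r : Hom (Z ⊗ X) Y) :
  compact_eval Y ∘ (compact_curry r ⊠ idm X) = r.
Proof.
unfold compact_eval, compact_curry.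
rewrite !tensorm_comp_id, !comp_assoc.
rewrite <- (comp_assoc _ _ (r ⊠ idm X' ⊠ idm X)), associator_nat, tensorm_id, comp_assoc.
(* Slide [r] past [c], so that it becomes the last factor and can be cancelled. *)
rewrite <- (comp_assoc _ _ (r ⊠ _)), tensorm_interchange, comp_assoc, runitor_nat.
rewrite <- (comp_id_r r) at 2; rewrite <- !comp_assoc; f_equal.
(* What remains is an endomorphism of [Z ⊗ X]; coherence turns it into [idm Z] tensored with the
   zigzag. *)
rewrite runitor_tensor, <- !comp_assoc, (comp_assoc _ (idm (Z ⊗ X) ⊠ c)).
rewrite <- (tensorm_id Z X), associator_nat.
rewrite <- !comp_assoc, (comp_assoc (associator Z X _)), pentagon.
rewrite <- !comp_assoc, (comp_assoc (associator Z X X' ⊠ _)), <- tensorm_comp_id.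
rewrite iso_hom_inv, tensorm_id, comp_id_l, (comp_assoc (associator Z _ X)).
rewrite associator_nat, <- (comp_assoc _ (associator Z _ X)), triangle_inv.
now rewrite <- !tensorm_id_comp, !comp_assoc, zigzag_dag.
Qed.

Lemma compact_curry_eval (Y : C) : compact_curry (compact_eval Y) = idm (Y ⊗ X').
Proof.
unfold compact_eval, compact_curry.
rewrite !tensorm_comp_id.
rewrite <- (comp_assoc _ _ (iso_inv (associator _ _ _))), pentagon_inv.
rewrite <- triangle, <- !comp_assoc, (comp_assoc (associator Y X' _)).
rewrite <- (tensorm_id Y X'), associator_nat, <- !comp_assoc.
assert (E : associator Y X' (munit C) ∘ iso_inv (runitor (Y ⊗ X')) =
            idm Y ⊠ iso_inv (runitor X')).
{ apply (iso_epi (i := runitor (Y ⊗ X'))).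
  rewrite <- comp_assoc, iso_inv_hom, comp_id_r, runitor_tensor, comp_assoc.
  now rewrite <- tensorm_id_comp, iso_inv_hom, tensorm_id, comp_id_l. }
rewrite E, (comp_assoc (idm Y ⊠ c ⊠ _)), <- associator_inv_nat, !comp_assoc.
rewrite <- (comp_assoc _ (associator _ _ _)), iso_hom_inv, comp_id_r.
now rewrite <- !tensorm_id_comp, zigzag_dual_dag.
Qed.

Lemma compact_eval_universal (Y : C) :
  is_universal_arrow (tensor_right X) (compact_eval Y).
Proof.
intros Z r; exists (compact_curry r); split; [apply compact_curryK|].
intros s <-; simpl; now rewrite compact_curry_comp, compact_curry_eval, comp_id_l.
Qed.

End CompactClosed.

(** * From universal relations to universal maps *)

(** Here [T] stands for [- ⊗ X], [tau] for [truth^†] and [V] for the monoidal unit; the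
    pullback of [k] and [t] collects the [g] for which [e ∘ J (T g)] is a map. *)
Lemma universal_arrow_of_relational (S R : Category) (J : Functor S R) (T : Functor S S)
    (I : S) (bang : forall X : S, Hom X I)
    (bang_uniq : forall (X : S) (f g : Hom X I), f = g)
    (Y PY : S) (sing : Hom Y PY) (mem : Hom (J PY) (J Y))
    (Omega : S) (truth : Hom I Omega) (chi : Hom PY Omega)
    (V : R) (tau : Hom (J Omega) V)
    (E F : S) (e : Hom (J (T E)) (J Y)) (f : Hom (J (T F)) V) :
  has_pullbacks S ->
  is_universal_arrow J mem -> mem ∘ fmap J sing = idm (J Y) -> is_mono sing ->
  is_pullback sing (bang Y) chi truth ->
  (forall (Z : S) (a b : Hom Z Omega), tau ∘ fmap J a = tau ∘ fmap J b -> a = b) ->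
  is_universal_arrow (comp_functor J T) e ->
  is_universal_arrow (comp_functor J T) f ->
  exists (H : S) (u : Hom (T H) Y), is_universal_arrow T u.
Proof.
intros pb memU mem_sing sing_mono [chi_sing chi_univ] tau_inj eU fU.
assert (memI := universal_arrow_inj memU).
assert (eI := universal_arrow_inj eU); assert (fI := universal_arrow_inj fU).
simpl in eI, fI.
(* [eh] is the transpose of [e]; [k] names the predicate that [eh] hits a singleton, and [t] names
   the predicate that is constantly true. *)
destruct (memU _ e) as [eh [ehE _]].
destruct (fU E (tau ∘ fmap J (chi ∘ eh))) as [k [kE _]].
destruct (fU I (tau ∘ fmap J (truth ∘ bang (T I)))) as [t [tE _]].
simpl in kE, tE.
assert (kg : forall Z (g : Hom Z E), f ∘ fmap J (fmap T (k ∘ g)) =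
               tau ∘ fmap J (chi ∘ (eh ∘ fmap T g))).
{ intros Z g; now rewrite !fmap_comp, !comp_assoc, kE, !fmap_comp, !comp_assoc. }
assert (tg : forall Z (b : Hom Z I), f ∘ fmap J (fmap T (t ∘ b)) =
               tau ∘ fmap J (truth ∘ bang (T Z))).
{ intros Z b; rewrite !fmap_comp, !comp_assoc, tE, <- !comp_assoc, <- !fmap_comp.
  now rewrite <- comp_assoc, (bang_uniq _ (bang (T I) ∘ _) (bang (T Z))). }
destruct (pb _ _ _ k t) as [H [p1 [p2 [pS pU]]]].
(* On the pullback the two predicates agree, so [eh ∘ fmap T p1] factors through [sing]; the factor
   [u] is the evaluation. *)
assert (chi_p1 : chi ∘ (eh ∘ fmap T p1) = truth ∘ bang (T H)).
{ apply tau_inj; now rewrite <- kg, pS, tg. }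
destruct (chi_univ _ _ _ chi_p1) as [u [[uE _] _]].
exists H, u; intros Z h.
destruct (eU Z (fmap J h)) as [g [gE _]]; simpl in gE.
(* A relation is the map [h] exactly when its transpose is [sing ∘ h]. *)
assert (ehg : forall g' : Hom Z E,
          e ∘ fmap J (fmap T g') = fmap J h <-> eh ∘ fmap T g' = sing ∘ h).
{ intros g'; rewrite <- ehE; split; intros Eg.
  - apply memI.
    now rewrite !fmap_comp, !comp_assoc, Eg, mem_sing, comp_id_l.
  - now rewrite <- comp_assoc, <- fmap_comp, Eg, fmap_comp, comp_assoc, mem_sing,
      comp_id_l. }
(* The name [g] of [h] satisfies the equation defining the pullback, since [chi ∘ sing] is
   constantly true. *)
assert (kt : k ∘ g = t ∘ bang Z).
{ apply fI; rewrite kg, tg, (proj1 (ehg g) gE), comp_assoc, chi_sing, <- comp_assoc.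
  now rewrite (bang_uniq _ (bang Y ∘ h) (bang (T Z))). }
destruct (pU _ _ _ kt) as [v [[vE _] vU]].
exists v; split.
- apply sing_mono.
  now rewrite comp_assoc, uE, <- comp_assoc, <- fmap_comp, vE; apply ehg.
(* For any competitor [v'], the composite [p1 ∘ v'] also names [h], hence equals [g]. *)
- intros v' v'E; apply vU; split; [| apply bang_uniq].
  apply eI; rewrite gE; apply ehg.
  now rewrite fmap_comp, comp_assoc, <- uE, <- comp_assoc, v'E.
Qed.

(** * Application to the category of maps *)

Lemma bang_eq (C : Category) (M : SymMonoidal C) (T : Semicartesian C) (X : C)
    (f g : Hom X (munit C)) : f = g.
Proof. now rewrite (bang_unique f), (bang_unique g). Qed.

(** The retraction [r] is only a relation: cancellation takes place in [R] and is reflected by the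
    faithful embedding. *)
Lemma split_map_mono (R : DaggerCompactQuantaloid) (X Y : R) (m : MapHom X Y)
    (r : Hom Y X) :
  r ∘ map_hom m = idm X -> is_mono (m : @Hom (Maps R) X Y).
Proof.
intros rm Z g h E; apply map_ext.
pose proof (f_equal (@map_hom R _ _) E) as E'; simpl in E'.
rewrite <- (comp_id_l (map_hom g)), <- (comp_id_l (map_hom h)), <- rm.
now rewrite <- !comp_assoc, E'.
Qed.

Theorem theorem8p14 (R : DaggerCompactQuantaloid)
    (semicartesian : Semicartesian (Maps R))
    (P : Functor R (Maps R))
    (singleton : NatTrans (id_functor (Maps R)) (comp_functor P (embedding R)))
    (member : NatTrans (comp_functor (embedding R) P) (id_functor R))
    (power_adjunction : is_adjunction singleton member)
    (Omega : Maps R) (truth : Hom (munit (Maps R)) Omega)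
    (true_bijective : forall X : Maps R,
       bijective (fun f : Hom X Omega =>
         (fmap (embedding R) truth)^† ∘ fmap (embedding R) f))
    (pullbacks : has_pullbacks (Maps R))
    (classifier : forall (A X : Maps R) (m : Hom A X), is_mono m ->
       exists! chi : Hom X Omega,
         classical chi /\ is_pullback m (bang A) chi truth) :
  symmetric_monoidal_closed (Maps R).
Proof.
intros X; apply universal_arrows_right_adjoint; intros Y.
(* Embedding and then tensoring in [R] has the same action, by conversion, as tensoring in [Maps R]
   and then embedding. *)
pose (rel_tensor := comp_functor (tensor_right (C := R) X) (embedding R)).
pose proof (adjunction_universal_arrow power_adjunction) as memU.
assert (relU : forall V : R, exists (E : Maps R) (e : Hom (rel_tensor E) V),
          is_universal_arrow rel_tensor e).
(* The representing object is [P] applied to [V ⊗ dual X]. *)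
{ intros V; eexists; eexists.
  exact (universal_arrow_comp (@compact_eval_universal R _ _ _ X V) (memU _)). }
(* A triangle identity makes [member Y] a retraction of the singleton in [R]. *)
assert (singM : is_mono (singleton Y))
  by exact (split_map_mono (proj1 power_adjunction Y)).
destruct (classifier _ _ _ singM) as [chi [[_ chiP] _]].
destruct (relU Y) as [E [e eU]], (relU (munit R)) as [F [f fU]].
refine (@universal_arrow_of_relational (Maps R) R (embedding R) (tensor_right X)
  (munit (Maps R)) bang (@bang_eq _ _ _) Y (P Y) (singleton Y) (member Y)
  Omega truth chi (munit R) ((map_hom truth)^†) E F e f pullbacks (memU Y)
  (proj1 power_adjunction Y) singM chiP _ eU fU).
intros Z; exact (bij_inj (true_bijective Z)).
Qed.
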